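(* Let $M$ be a smooth odd-dimensional manifold and let $\mathcal J=(F,\eta,\pi,\theta,\varphi)$ represent a generalized contact structure on $M$ (that is, a generalized almost contact structure such that $\Gamma(L)$ is closed under the Courant bracket), with associated bundle map $\Phi$ and associated bundles $L=L_F\oplus E^{(1,0)}$ and $L^*=L_\eta\oplus E^{(0,1)}$. Then the pair $L$ and $L^*$ forms a Lie bialgebroid (with respect to the restrictions of the Courant bracket and of the anchor $\rho$) if and only if $d\eta$ is of type $(1,1)$ with respect to the map $\Phi$ on $(\ker\eta\oplus\ker F)_{\mathbb C}$.
   Context: Setting: on sections of $TM\oplus T^*M$ put $\langle X+\alpha,Y+\beta\rangle=\frac12(\iota_X\beta+\iota_Y\alpha)$ and the Courant bracket $[\![X+\alpha,Y+\beta]\!]=[X,Y]+\mathcal L_X\beta-\mathcal L_Y\alpha-\frac12 d(\iota_X\beta-\iota_Y\alpha)$. Both are extended complex-linearly to $(TM\oplus T^*M)_{\mathbb C}$, and $\rho$ denotes the projection (anchor) onto $TM_{\mathbb C}$. For a 2-form $\theta$, $\theta^\flat X=\theta(X,\cdot)$; for a bivector field $\pi$, $(\pi^\sharp\alpha)(\beta)=\pi(\alpha,\beta)$; for a $(1,1)$-tensor $\varphi$, $\varphi^*\alpha=\alpha\circ\varphi$. A generalized almost contact pair on $M$ is a bundle endomorphism $\Phi$ of $TM\oplus T^*M$ together with a section $F+\eta$ ($F$ a vector field, $\eta$ a 1-form) such that $\Phi+\Phi^*=0$ (adjoint with respect to $\langle\cdot,\cdot\rangle$), $\eta(F)=1$,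 $\Phi(F)=0$, $\Phi(\eta)=0$ and $\Phi\circ\Phi=-\mathbb I+F\odot\eta$, where $(F\odot\eta)(X+\alpha)=\eta(X)F+\alpha(F)\eta$. Two pairs are equivalent if they have the same $\Phi$ and $\eta'=f\eta$, $F'=\frac1fF$ for a nowhere-zero function $f$; a generalized almost contact structure is an equivalence class. In components $\Phi=\begin{pmatrix}\varphi&\pi^\sharp\\ \theta^\flat&-\varphi^*\end{pmatrix}$ with $\varphi$ a $(1,1)$-tensor, $\pi$ a bivector field, $\theta$ a 2-form, and the structure is denoted $\mathcal J=(F,\eta,\pi,\theta,\varphi)$. Bundles: $\ker\eta\subset TM$ and $\ker F=\{\alpha\in T^*M:\alpha(F)=0\}$; $L_F$ and $L_\eta$ are the complex line bundles spanned by $F$ and $\eta$; $E^{(1,0)}=\{e-i\Phi(e): e\in\ker\eta\oplus\ker F\}$, $E^{(0,1)}=\{e+i\Phi(e): e\in\ker\eta\oplus\ker F\}$ (the $+i$ and $-i$ eigenbundles of $\Phi$). $L^*$ is identified with the dual of $L$, and $E^{(0,1)}$ with the dual of $E^{(1,0)}$, through $\langle\cdot,\cdot\rangle$. Type: $(\rho^*d\eta)(u,v)=d\eta(\rho(u),\rho(v))$ for $u,v\in(\ker\eta\oplus\ker F)_{\mathbb C}=E^{(1,0)}\oplus E^{(0,1)}$. Its $(2,0)$ part is its component in $\wedge^2E^{(1,0)}$, i.e. (under the duality) its restriction to pairs of elements of $E^{(0,1)}$; its $(0,2)$ part is its restriction to pairs of elements of $E^{(1,0)}$. ''$d\eta$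 is of type $(1,1)$'' means that both the $(2,0)$ and the $(0,2)$ parts vanish. Lie bialgebroid: a pair $(A,A^* )$ of Lie algebroids in duality, such that the Lie algebroid differential $d_{A^*}$ (acting on $\Gamma(\wedge^\bullet A)$) satisfies $d_{A^*}[a_1,a_2]=[d_{A^*}a_1,a_2]+[a_1,d_{A^*}a_2]$ for all $a_1,a_2\in\Gamma(A)$. In particular, for $(L,L^* )$ to form one, both $\Gamma(L)$ and $\Gamma(L^* )$ must be closed under the Courant bracket. *)

(* Defs.v *)
From HB Require Import structures.
From mathcomp Require Import all_boot all_order all_algebra.
From mathcomp Require Import all_classical all_reals all_analysis.
From mathcomp Require Import ssrAC ring.
Set Implicit Arguments.
Unset Strict Implicit.
Unset Printing Implicit Defensive.
Import Order.TTheory GRing.Theory Num.Theory numFieldNormedType.Exports.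
Local Open Scope classical_set_scope.
Local Open Scope ring_scope.

(* * Smooth maps between open subsets of normed spaces *)

(* Intended for [U] open and [V] of finite dimension, where asking for all
   directional derivatives is the same as asking for the partial ones. *)
Fixpoint Ck_on (R : realType) (V W : normedModType R) (k : nat) (U : set V)
    (f : V -> W) : Prop :=
  (forall x, U x -> {for x, continuous f}) /\
  if k is k'.+1 then
    forall v, (forall x, U x -> derivable f x v) /\ Ck_on k' U ('D_v f)
  else True.

Definition smooth_on (R : realType) (V W : normedModType R) (U : set V)
  (f : V -> W) : Prop := forall k, Ck_on k U f.

Section SmoothOnTheory.
Variables (R : realType) (V : normedModType R) (U : set V).
Hypothesis oU : open U.

Lemma Ck_onE (W : normedModType R) k (f : V -> W) : Ck_on k U f =
  ((forall x, U x -> {for x, continuous f}) /\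
   if k is k'.+1 then
     forall v, (forall x, U x -> derivable f x v) /\ Ck_on k' U ('D_v f)
   else True).
Proof. by case: k. Qed.

Lemma Ck_onW (W : normedModType R) k (f : V -> W) :
  Ck_on k.+1 U f -> Ck_on k U f.
Proof.
elim: k f => [|k IH] f [cf df]; first by split.
by split=> // v; have [dv Dv] := df v; split=> //; apply: IH.
Qed.

Lemma eq_Ck_on (W : normedModType R) k (f g : V -> W) :
  (forall x, U x -> f x = g x) -> Ck_on k U f -> Ck_on k U g.
Proof.
elim: k f g => [|k IH] f g fg [cf df].
all: have nfg x : U x -> {near x, f =1 g}
  by (move=> Ux; apply: filterS (open_nbhs_nbhs (conj oU Ux)) => y; apply: fg).
all: split=> [x Ux|//].
1,2: rewrite /prop_for /continuous_at -(fg x Ux).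
1,2: by apply: cvg_trans (cf x Ux); apply: near_eq_cvg; exact: nfg.
move=> v; have [dv Dv] := df v; split=> [x Ux|].
  exact: near_eq_derivable (nfg x Ux) (dv x Ux).
apply: IH Dv => x Ux; exact: near_eq_derive (nfg x Ux).
Qed.

Lemma Ck_on_cst (W : normedModType R) k (c : W) : Ck_on k U (cst c).
Proof.
elim: k c => [|k IH] c; (split=> [x _|//]; first exact: cst_continuous).
move=> v; split=> [x _|]; first exact: derivable_cst.
by apply: eq_Ck_on (IH 0) => x _; rewrite derive_cst.
Qed.

Lemma Ck_onD (W : normedModType R) k (f g : V -> W) :
  Ck_on k U f -> Ck_on k U g -> Ck_on k U (f + g).
Proof.
elim: k f g => [|k IH] f g [cf df] [cg dg].
all: split=> [x Ux|//]; first by apply: continuousD; [exact: cf|exact: cg].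
move=> v; have [dfv Df] := df v; have [dgv Dg] := dg v; split=> [x Ux|].
  by apply: derivableD; [exact: dfv|exact: dgv].
by apply: eq_Ck_on (IH _ _ Df Dg) => x Ux; rewrite deriveD//;
  [exact: dfv|exact: dgv].
Qed.

Lemma Ck_onN (W : normedModType R) k (f : V -> W) :
  Ck_on k U f -> Ck_on k U (- f).
Proof.
elim: k f => [|k IH] f [cf df].
all: split=> [x Ux|//]; first by apply: continuousN; exact: cf.
move=> v; have [dfv Df] := df v; split=> [x Ux|].
  by apply: derivableN; exact: dfv.
by apply: eq_Ck_on (IH _ Df) => x Ux; rewrite deriveN//; exact: dfv.
Qed.

Lemma Ck_onM k (f g : V -> R) :
  Ck_on k U f -> Ck_on k U g -> Ck_on k U (f * g).
Proof.
elim: k f g => [|k IH] f g Cf Cg; have [cf df] := Cf; have [cg dg] := Cg.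
all: split=> [x Ux|//]; first by apply: continuousM; [exact: cf|exact: cg].
move=> v; have [dfv Df] := df v; have [dgv Dg] := dg v; split=> [x Ux|].
  by apply: derivableM; [exact: dfv|exact: dgv].
apply: eq_Ck_on (Ck_onD (IH _ _ (Ck_onW Cf) Dg) (IH _ _ (Ck_onW Cg) Df)) => x Ux.
by rewrite deriveM//; [exact: dfv|exact: dgv].
Qed.

End SmoothOnTheory.

(* * Smooth manifolds *)

Record chart (R : realType) (n : nat) (T : topologicalType) := Chart {
  chart_dom : set T;
  chart_map : T -> 'rV[R]_n;
  chart_inv : 'rV[R]_n -> T;
  chart_dom_open : open chart_dom;
  chart_img_open : open (chart_map @` chart_dom);
  chart_mapK : forall x, chart_dom x -> chart_inv (chart_map x) = x;
  chart_map_continuous :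
    forall x, chart_dom x -> {for x, continuous chart_map};
  chart_inv_continuous :
    forall y, (chart_map @` chart_dom) y -> {for y, continuous chart_inv} }.

Definition chart_compatible (R : realType) (n : nat) (T : topologicalType)
    (c c' : chart R n T) : Prop :=
  smooth_on (chart_map c @` (chart_dom c `&` chart_dom c'))
    (chart_map c' \o chart_inv c).

(* The atlas is not required to be maximal: smoothness of a function is the
   same for an atlas and for the maximal one containing it. *)
Record smooth_manifold (R : realType) (n : nat) := SmoothManifold {
  mcarrier :> topologicalType;
  mhausdorff : hausdorff_space mcarrier;
  msecond_countable : @second_countable mcarrier;
  atlas : set (chart R n mcarrier);
  atlas_cover : forall x, exists2 c, atlas c & chart_dom c x;
  atlas_compatible :
    forall c c', atlas c -> atlas c' -> chart_compatible c c' }.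

(* * The ring of smooth functions *)

Section SmoothFunctions.
Variables (R : realType) (n : nat) (M : smooth_manifold R n).

Definition is_smooth (f : M -> R) : Prop :=
  forall c, atlas c ->
    smooth_on (chart_map c @` chart_dom c) (f \o chart_inv c).

Definition smooth_pred : {pred M -> R} := fun f => `[< is_smooth f >].

Record smooth_fun := SmoothFun {
  smooth_val :> M -> R;
  smooth_valP : smooth_val \in smooth_pred }.

HB.instance Definition _ := [isSub for smooth_val].
HB.instance Definition _ := [Choice of smooth_fun by <:].

Lemma smooth_subring_closed : subring_closed smooth_pred.
Proof.
split=> [|f g /asboolP sf /asboolP sg|f g /asboolP sf /asboolP sg].
all: apply/asboolP => c ac k; have oc := @chart_img_open _ _ _ c.
- exact: Ck_on_cst.
- apply: (Ck_onD oc (sf c ac k)); exact: (Ck_onN oc (sg c ac k)).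
- exact: (Ck_onM oc (sf c ac k) (sg c ac k)).
Qed.

HB.instance Definition _ := GRing.SubChoice_isSubComPzRing.Build
  (M -> R) smooth_pred smooth_fun smooth_subring_closed.

Lemma smooth_cst_subproof (r : R) : (cst r : M -> R) \in smooth_pred.
Proof.
by apply/asboolP => c ac k; apply: Ck_on_cst; exact: chart_img_open.
Qed.

Definition smooth_cst (r : R) : smooth_fun := SmoothFun (smooth_cst_subproof r).

End SmoothFunctions.

Notation "'C^oo' M" := (smooth_fun M) (at level 9, M at level 9).

(* * Vector fields and differential forms *)

(* Tensor fields are represented by their action on global sections: vector
   fields are the derivations of the algebra C^oo(M), 1-forms the
   C^oo(M)-linear maps from vector fields to functions, and bundle maps the
   C^oo(M)-linear maps between the modules of sections. *)

Section VectorFields.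
Variables (R : realType) (n : nat) (M : smooth_manifold R n).
Local Notation C := (C^oo M).

Definition is_derivation (X : C -> C^o) : Prop :=
  [/\ forall f g, X (f + g) = X f + X g,
      forall r f, X (smooth_cst M r * f) = smooth_cst M r * X f
    & forall f g, X (f * g) = X f * g + f * X g].

Definition derivation_pred : {pred C -> C^o} := fun X => `[< is_derivation X >].

Record vector_field := VectorField {
  vf_val :> C -> C^o;
  vf_valP : vf_val \in derivation_pred }.

HB.instance Definition _ := [isSub for vf_val].
HB.instance Definition _ := [Choice of vector_field by <:].

Lemma derivation_submod_closed : submod_closed derivation_pred.
Proof.
split=> [|h X Y /asboolP [XD XZ XM] /asboolP [YD YZ YM]]; apply/asboolP.
  split=> [f g|r f|f g]; rewrite -[(0 : C -> C^o) _]/(0 : C).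
  - by rewrite addr0.
  - by rewrite mulr0.
  - by rewrite mul0r mulr0 addr0.
split=> [f g|r f|f g]; rewrite -![(h *: X + Y) _]/(h * X _ + Y _ : C).
- by rewrite XD YD mulrDr addrACA.
- by rewrite XZ YZ mulrDr mulrCA.
- by rewrite XM YM !mulrDr mulrDl !mulrA (mulrC h f) addrACA.
Qed.

HB.instance Definition _ := GRing.SubChoice_isSubLmodule.Build
  C (C -> C^o) derivation_pred vector_field derivation_submod_closed.

Lemma vfP (X : vector_field) : is_derivation X.
Proof. exact/asboolP/(vf_valP X). Qed.

Lemma lie_bracket_subproof (X Y : vector_field) :
  (fun f => X (Y f) - Y (X f)) \in derivation_pred.
Proof.
have [XD XZ XM] := vfP X; have [YD YZ YM] := vfP Y.
apply/asboolP; split=> [f g|r f|f g].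
- by rewrite YD XD XD YD opprD addrACA.
- by rewrite YZ XZ XZ YZ mulrBr.
rewrite YM XM XD YD !XM !YM; ring.
Qed.

Definition lie_bracket (X Y : vector_field) : vector_field :=
  VectorField (lie_bracket_subproof X Y).

Definition is_tensorial (a : vector_field -> C^o) : Prop :=
  forall f X Y, a (f *: X + Y) = f * a X + a Y.

Definition tensorial_pred : {pred vector_field -> C^o} :=
  fun a => `[< is_tensorial a >].

Record one_form := OneForm {
  form_val :> vector_field -> C^o;
  form_valP : form_val \in tensorial_pred }.

HB.instance Definition _ := [isSub for form_val].
HB.instance Definition _ := [Choice of one_form by <:].

Lemma tensorial_submod_closed : submod_closed tensorial_pred.
Proof.
split=> [|h a b /asboolP aL /asboolP bL]; apply/asboolP => f X Y.
  by rewrite -![(0 : vector_field -> C^o) _]/(0 : C) mulr0 addr0.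
rewrite -![(h *: a + b) _]/(h * a _ + b _ : C) aL bL; ring.
Qed.

HB.instance Definition _ := GRing.SubChoice_isSubLmodule.Build
  C (vector_field -> C^o) tensorial_pred one_form tensorial_submod_closed.

Lemma form_linear (a : one_form) : is_tensorial a.
Proof. exact/asboolP/(form_valP a). Qed.

Lemma vf_eqP (X Y : vector_field) : (forall f, X f = Y f) -> X = Y.
Proof. by move=> XY; apply/val_inj/funext. Qed.

Lemma vfDE (X Y : vector_field) f : (X + Y) f = X f + Y f.
Proof. by []. Qed.

Lemma vfZE h (X : vector_field) f : (h *: X) f = h * X f.
Proof. by []. Qed.

Lemma dfun_subproof (f : C) : (fun X : vector_field => X f) \in tensorial_pred.
Proof. by apply/asboolP. Qed.

Definition dfun (f : C) : one_form := OneForm (dfun_subproof f).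

Lemma lie_bracket_linear (X : vector_field) f (Y Z : vector_field) :
  lie_bracket X (f *: Y + Z) =
  f *: lie_bracket X Y + X f *: Y + lie_bracket X Z.
Proof.
apply: vf_eqP => g; have [XD XZ XM] := vfP X.
rewrite !(vfDE, vfZE) -![lie_bracket X _ g]/(X (_ g) - _ (X g)).
rewrite !(vfDE, vfZE) XD XM; ring.
Qed.

Lemma lie_derivative_subproof (X : vector_field) (a : one_form) :
  (fun Y => X (a Y) - a (lie_bracket X Y)) \in tensorial_pred.
Proof.
apply/asboolP => f Y Z; have [XD XZ XM] := vfP X.
rewrite lie_bracket_linear -addrA !form_linear XD XM; ring.
Qed.

Definition lie_derivative (X : vector_field) (a : one_form) : one_form :=
  OneForm (lie_derivative_subproof X a).

Definition exterior_d (a : one_form) (X Y : vector_field) : C :=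
  X (a Y) - Y (a X) - a (lie_bracket X Y).

Definition gsection : Type := (vector_field * one_form)%type.
HB.instance Definition _ := GRing.Lmodule.on gsection.

Definition smooth_half : C := smooth_cst M 2^-1.

Definition pairing (e e' : gsection) : C := smooth_half * (e'.2 e.1 + e.2 e'.1).

Definition courant (e e' : gsection) : gsection :=
  (lie_bracket e.1 e'.1,
   lie_derivative e.1 e'.2 - lie_derivative e'.1 e.2
   - smooth_half *: dfun (e'.2 e.1 - e.2 e'.1)).

End VectorFields.

(* * Complexification *)

(* [(a, b)] stands for [a + i b]. *)
Definition complexification (V : Type) : Type := (V * V)%type.
Notation "V ^cplx" := (complexification V) (at level 2, format "V ^cplx").

HB.instance Definition _ (V : zmodType) := GRing.Zmodule.on (V^cplx).

Definition of_real (V : zmodType) (v : V) : V^cplx := (v, 0).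
Definition add_i (V : Type) (v w : V) : V^cplx := (v, w).

Definition linC (U V : Type) (f : U -> V) (u : U^cplx) : V^cplx :=
  (f u.1, f u.2).
Definition bilinC (U V : Type) (W : zmodType) (B : U -> V -> W)
  (u : U^cplx) (v : V^cplx) : W^cplx :=
  (B u.1 v.1 - B u.2 v.2, B u.1 v.2 + B u.2 v.1).

Section ComplexRing.
Variable A : comPzRingType.
Let one : A^cplx := (1, 0).
Let mul : A^cplx -> A^cplx -> A^cplx := bilinC *%R.
Let cE (u v : A^cplx) : u.1 = v.1 -> u.2 = v.2 -> u = v.
Proof. by case: u v => [? ?] [? ?] /= -> ->. Qed.
Let mulA : associative mul.
Proof. by move=> u v w; apply: cE => /=; ring. Qed.
Let mulC : commutative mul.
Proof. by move=> u v; apply: cE => /=; ring. Qed.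
Let mul1 : left_id one mul.
Proof. by move=> u; apply: cE => /=; ring. Qed.
Let mulDl : left_distributive mul +%R.
Proof. by move=> u v w; apply: cE => /=; ring. Qed.
HB.instance Definition _ :=
  GRing.Zmodule_isComPzRing.Build (A^cplx) mulA mulC mul1 mulDl.
End ComplexRing.

Section ComplexModule.
Variables (A : comPzRingType) (V : lmodType A).
Let scale : A^cplx -> V^cplx -> V^cplx := bilinC *:%R.
Let cE (u v : V^cplx) : u.1 = v.1 -> u.2 = v.2 -> u = v.
Proof. by case: u v => [? ?] [? ?] /= -> ->. Qed.
Let scaleA a b v : scale a (scale b v) = scale (a * b) v.
Proof.
apply: cE; rewrite /scale/= ?scalerBr ?scalerDr ?scalerDl ?scalerBl !scalerA.
  by rewrite !opprD !addrA [LHS](ACl (1*4*2*3)) /= scaleNr.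
by rewrite !addrA [LHS](ACl (1*4*2*3)) /= scaleNr.
Qed.
Let scale1 : left_id 1 scale.
Proof.
by move=> v; apply: cE; rewrite /scale/= scale1r scale0r ?subr0 ?addr0.
Qed.
Let scaleDr : right_distributive scale +%R.
Proof.
move=> a u v; apply: cE; rewrite /scale/= !scalerDr ?opprD.
all: exact: addrACA.
Qed.
Let scaleDl v : {morph scale^~ v : a b / a + b}.
Proof.
move=> a b; apply: cE; rewrite /scale/= !scalerDl ?opprD.
all: exact: addrACA.
Qed.
HB.instance Definition _ := GRing.Zmodule_isLmodule.Build (A^cplx) (V^cplx)
  scaleA scale1 scaleDr scaleDl.
End ComplexModule.

(* * Lie algebroids and Lie bialgebroids inside (TM + T*M) (x) C *)

(* A complex subbundle is represented by its set of sections. *)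
Section LieBialgebroids.
Variables (R : realType) (n : nat) (M : smooth_manifold R n).
Local Notation C := (C^oo M).
Local Notation E := (gsection M).

Definition anchor (u : E^cplx) : (vector_field M)^cplx := linC fst u.
Definition vf_action : (vector_field M)^cplx -> C^cplx -> C^cplx :=
  bilinC (fun (X : vector_field M) (f : C) => X f : C).
Definition cpairing : E^cplx -> E^cplx -> C^cplx := bilinC (@pairing R n M).
Definition ccourant : E^cplx -> E^cplx -> E^cplx := bilinC (@courant R n M).

Local Notation "'rho' u" := (vf_action (anchor u)) (at level 10, u at level 9).
Local Notation "<< u , v >>" := (cpairing u v).
Local Notation "[[ u , v ]]" := (ccourant u v).

Definition courant_closed (A : set E^cplx) : Prop :=
  forall u v, A u -> A v -> A [[u, v]].

(* The Courant bracket is bilinear over the constants, so bilinearity of its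
   restriction needs no clause. *)
Definition lie_algebroid (A : set E^cplx) : Prop :=
  [/\ A 0,
      forall (f : C^cplx) u v, A u -> A v -> A (f *: u + v),
      courant_closed A
    & [/\ forall u v, A u -> A v -> [[u, v]] = - [[v, u]],
          forall u v w, A u -> A v -> A w ->
            [[u, [[v, w]]]] + [[v, [[w, u]]]] + [[w, [[u, v]]]] = 0
        & forall (f : C^cplx) u v, A u -> A v ->
            [[u, f *: v]] = f *: [[u, v]] + (rho u f) *: v] ].

(* Sections of [A], and of its exterior powers, are identified with the
   multilinear forms they define on [B] through the pairing; the following
   definitions are meant for [B] dual to [A]. *)

Definition dual_under_pairing (A B : set E^cplx) : Prop :=
  (forall u, A u -> (forall x, B x -> <<u, x>> = 0) -> u = 0) /\
  (forall x, B x -> (forall u, A u -> <<u, x>> = 0) -> x = 0).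

(* The Lie derivative along a section [u] of [A] of the section [x] of the dual
   bundle [B]. *)
Definition dual_lie_derivative (A B : set E^cplx) (u x : E^cplx) : E^cplx :=
  xget 0 [set y | B y /\
    forall v, A v -> <<v, y>> = rho u <<v, x>> - <<[[u, v]], x>>].

(* The differential of the Lie algebroid [B] on a section [u] of its dual. *)
Definition algebroid_d (u x y : E^cplx) : C^cplx :=
  rho x <<u, y>> - rho y <<u, x>> - <<u, [[x, y]]>>.

(* The Schouten brackets [u, P] and [P, u] of a section [u] and a bisection [P]
   of [A]. *)
Definition schouten12 (A B : set E^cplx) (u : E^cplx)
    (P : E^cplx -> E^cplx -> C^cplx) (x y : E^cplx) : C^cplx :=
  rho u (P x y) - P (dual_lie_derivative A B u x) y
  - P x (dual_lie_derivative A B u y).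
Definition schouten21 (A B : set E^cplx) (P : E^cplx -> E^cplx -> C^cplx)
    (u : E^cplx) (x y : E^cplx) : C^cplx := - schouten12 A B u P x y.

Definition lie_bialgebroid (A B : set E^cplx) : Prop :=
  [/\ dual_under_pairing A B, lie_algebroid A, lie_algebroid B
    & forall u v, A u -> A v -> forall x y, B x -> B y ->
        algebroid_d [[u, v]] x y =
        schouten21 A B (algebroid_d u) v x y +
        schouten12 A B u (algebroid_d v) x y].

End LieBialgebroids.

(* * Generalized almost contact pairs *)

Record gac_pair (R : realType) (n : nat) (M : smooth_manifold R n) := GacPair {
  gac_Phi : {linear gsection M -> gsection M};
  gac_F : vector_field M;
  gac_eta : one_form M;
  gac_skew : forall e e',
    pairing (gac_Phi e) e' + pairing e (gac_Phi e') = 0;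
  gac_eta_F : gac_eta gac_F = 1;
  gac_Phi_F : gac_Phi (gac_F, 0) = 0;
  gac_Phi_eta : gac_Phi (0, gac_eta) = 0;
  gac_Phi_sqr : forall e, gac_Phi (gac_Phi e) =
    - e + (gac_eta e.1 *: gac_F, e.2 gac_F *: gac_eta) }.

Section ContactBundles.
Variables (R : realType) (n : nat) (M : smooth_manifold R n) (J : gac_pair M).
Local Notation C := (C^oo M).
Local Notation E := (gsection M).
Local Notation Phi := (gac_Phi J).
Local Notation F := (gac_F J).
Local Notation eta := (gac_eta J).

Definition ker_eta_F : set E := [set e : E | eta e.1 = 0 /\ e.2 F = 0].

Definition E10 : set E^cplx := [set add_i e (- Phi e) | e in ker_eta_F].
Definition E01 : set E^cplx := [set add_i e (Phi e) | e in ker_eta_F].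

Definition gac_L : set E^cplx :=
  [set u | exists (f : C^cplx) w, E10 w /\ u = f *: of_real ((F, 0) : E) + w].
Definition gac_Lstar : set E^cplx :=
  [set u | exists (f : C^cplx) w, E01 w /\ u = f *: of_real ((0, eta) : E) + w].

Definition generalized_contact : Prop := courant_closed gac_L.

Definition rho_d_eta (u v : E^cplx) : C^cplx :=
  bilinC (exterior_d eta) (anchor u) (anchor v).

Definition d_eta_type11 : Prop :=
  (forall u v, E01 u -> E01 v -> rho_d_eta u v = 0) /\
  (forall u v, E10 u -> E10 v -> rho_d_eta u v = 0).

End ContactBundles.

(* Main.v *)
Require Import Defs.
From mathcomp Require Import all_boot all_order all_algebra.
From mathcomp Require Import all_classical all_reals all_analysis.
From mathcomp Require Import ssrAC ring.
Set Implicit Arguments.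
Unset Strict Implicit.
Unset Printing Implicit Defensive.
Import Order.TTheory GRing.Theory Num.Theory.
Local Open Scope ring_scope.

(** Write [u ∘ v = [[u, v]] + D <<u, v>>] for the Dorfman bracket, where
    [D f = (0, df)].  It satisfies the Jacobi identity
    [u ∘ (v ∘ w) = (u ∘ v) ∘ w + v ∘ (u ∘ w)], the Leibniz rule
    [u ∘ (f v) = (rho u f) v + f (u ∘ v)], and the pairing is invariant:
    [rho u <<v, w>> = <<u ∘ v, w>> + <<v, u ∘ w>>].  These three identities are
    checked for real sections and have the common shape
    [f u (g v w) = h (k u v) w + l v (m u w)]; [bilinC_derivation] transports any
    identity of this shape to complexifications.

    On an isotropic submodule the Courant and Dorfman brackets coincide, so an
    isotropic submodule closed under the bracket is a Lie algebroid.  If [A] and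
    [B] are complementary, isotropic and closed, then for [u] in [A] and [x], [y]
    in [B] the differential of [B] is [d u (x, y) = - <<u ∘ x, y>>], and the Lie
    derivative along [u] of [x] is the [B]-component of [u ∘ x].  The compatibility
    condition then becomes the Jacobi identity for [u], [v], [x] paired with [y]:
    as in the theorem of Liu, Weinstein and Xu on transverse Dirac structures,
    [(A, B)] is a Lie bialgebroid if and only if [A] and [B] are both closed
    ([transverse_lie_bialgebroid]).

    The submodules [gac_L J] and [gac_Lstar J] are isotropic and complementary,
    and [gac_L J] is closed by assumption, so only the closedness of [gac_Lstar J]
    matters.  For isotropic [B] the expression [<<u ∘ v, w>>] is invariant under
    cyclic permutations of [u], [v], [w] in [B], and [B] is closed when it vanishes
    ([B] is its own orthogonal).  On [gac_Lstar J] it vanishes on three sections of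
    [E01 J], because these are conjugate to sections of [gac_L J].  When one of the
    three is [eta], it is, up to the factor [-1/2], the value of [d eta] on the
    anchors of the two others.  So [gac_Lstar J] is closed if and only if [d eta]
    vanishes on pairs of sections of [E01 J], and by conjugation this amounts to
    [d eta] being of type (1,1). *)

(** * Biadditive maps and their complex-bilinear extensions *)

Lemma cplx_eq (V : Type) (u v : V^cplx) : u.1 = v.1 -> u.2 = v.2 -> u = v.
Proof. by case: u v => [? ?] [? ?] /= -> ->. Qed.

Section Bilinear.

(** Additivity in each of the two arguments. *)
Definition biadditive (U V W : zmodType) (f : U -> V -> W) : Prop :=
  (forall v, {morph f^~ v : x y / x + y}) /\ (forall u, {morph f u : x y / x + y}).

Lemma morphD0 (U V : zmodType) (f : U -> V) : {morph f : x y / x + y} -> f 0 = 0.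
Proof. by move=> fD; apply: (addrI (f 0)); rewrite -fD !addr0. Qed.

Lemma morphDN (U V : zmodType) (f : U -> V) :
  {morph f : x y / x + y} -> {morph f : x / - x}.
Proof.
by move=> fD x; apply: (addrI (f x)); rewrite -fD !subrr morphD0.
Qed.

Variables (U V W : zmodType).

Lemma biadditiveBr (f : U -> V -> W) : biadditive f ->
  forall u v w, f u (v - w) = f u v - f u w.
Proof. by move=> [_ fD] u v w; rewrite fD (morphDN (fD u)). Qed.

Lemma biadditiveBl (f : U -> V -> W) : biadditive f ->
  forall u v w, f (v - w) u = f v u - f w u.
Proof. by move=> [fD _] u v w; rewrite fD (morphDN (fD u)). Qed.

Lemma biadditiveNr (f : U -> V -> W) : biadditive f ->
  forall u v, f u (- v) = - f u v.
Proof. by move=> [_ fD] u v; rewrite (morphDN (fD u)). Qed.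

Lemma biadditiveNl (f : U -> V -> W) : biadditive f ->
  forall u v, f (- v) u = - f v u.
Proof. by move=> [fD _] u v; rewrite (morphDN (fD u)). Qed.

Lemma bilinC_biadditive (f : U -> V -> W) : biadditive f ->
  biadditive (bilinC f : U^cplx -> V^cplx -> W^cplx).
Proof.
move=> [fl fr]; split=> [v x y|u x y]; apply: cplx_eq; rewrite /= ?fl ?fr ?opprD.
all: exact: addrACA.
Qed.

End Bilinear.

(** A derivation-like identity between biadditive maps extends to
    complexifications.  Jacobi identities, invariance of a pairing and Leibniz
    rules are all of this form. *)
Lemma bilinC_derivation (U V W X Y Z T : zmodType) (f : U -> X -> T) (g : V -> W -> X)
  (h : Y -> W -> T) (k : U -> V -> Y) (l : V -> Z -> T) (m : U -> W -> Z) :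
  biadditive f -> biadditive h -> biadditive l ->
  (forall u v w, f u (g v w) = h (k u v) w + l v (m u w)) ->
  forall u v w, bilinC f u (bilinC g v w) =
    bilinC h (bilinC k u v) w + bilinC l v (bilinC m u w).
Proof.
move=> fA hA lA id u v w.
apply: cplx_eq; rewrite /= (biadditiveBr fA) (fA.2) !id (biadditiveBl hA) (hA.1).
  by rewrite (biadditiveBr lA) lA.2 !opprD !addrA [LHS](ACl (1*7*3*5*2*6*4*8)).
by rewrite (lA.2 v.1) (biadditiveBr lA) !opprD !addrA [LHS](ACl (1*7*3*5*2*6*4*8)).
Qed.

(** * The Dorfman bracket of real sections *)

(* With these settings simplification stops at the value of a form or of a
   vector field, so that the rewriting rules below apply. *)
#[local] Arguments form_val : simpl never.
#[local] Arguments vf_val : simpl never.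

Section Real.
Variables (R : realType) (n : nat) (M : smooth_manifold R n).
Local Notation C := (C^oo M).
Local Notation E := (gsection M).
Local Notation half := (smooth_half M).

Lemma vfD (X : vector_field M) (f g : C) : X (f + g) = X f + X g.
Proof. by have [->] := vfP X. Qed.
Lemma vfN (X : vector_field M) (f : C) : X (- f) = - X f.
Proof. by apply: (morphDN (f := X : C -> C)) => ? ?; exact: vfD. Qed.
Lemma vfH (X : vector_field M) (f : C) : X (half * f) = half * X f.
Proof. by have [_ ->] := vfP X. Qed.
Lemma vfM (X : vector_field M) (f g : C) : X (f * g) = X f * g + f * X g.
Proof. by have [_ _ ->] := vfP X. Qed.

Lemma vfNE (X : vector_field M) (f : C) : (- X) f = - X f.
Proof. by rewrite -scaleN1r vfZE mulN1r. Qed.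

Lemma one_formD (a : one_form M) (X Y : vector_field M) : a (X + Y) = a X + a Y.
Proof. by rewrite -{1}[X]scale1r form_linear mul1r. Qed.
Lemma one_form0 (a : one_form M) : a 0 = 0.
Proof. by apply: (morphD0 (f := a : _ -> C)) => ? ?; exact: one_formD. Qed.
Lemma one_formN (a : one_form M) (X : vector_field M) : a (- X) = - a X.
Proof. by apply: (morphDN (f := a : _ -> C)) => ? ?; exact: one_formD. Qed.
Lemma one_formZ (a : one_form M) (f : C) (X : vector_field M) : a (f *: X) = f * a X.
Proof. by rewrite -{1}[f *: X]addr0 form_linear one_form0 addr0. Qed.

Lemma one_form_eqP (a b : one_form M) : (forall X, a X = b X) -> a = b.
Proof. by move=> ab; apply/val_inj/funext. Qed.

Lemma one_formDE (a b : one_form M) (X : vector_field M) :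
  (a + b) X = a X + b X.
Proof. by []. Qed.
Lemma one_formZE (a : one_form M) (f : C) (X : vector_field M) :
  (f *: a) X = f * a X.
Proof. by []. Qed.
Lemma one_formNE (a : one_form M) (X : vector_field M) : (- a) X = - a X.
Proof. by rewrite -scaleN1r one_formZE mulN1r. Qed.
Lemma one_form0E (X : vector_field M) : (0 : one_form M) X = 0. Proof. by []. Qed.
Lemma dfunE (f : C) (X : vector_field M) : dfun f X = X f. Proof. by []. Qed.
Lemma lie_bracketE (X Y : vector_field M) f :
  lie_bracket X Y f = X (Y f) - Y (X f).
Proof. by []. Qed.
Lemma lie_derivativeE (X Y : vector_field M) a :
  lie_derivative X a Y = X (a Y) - a (lie_bracket X Y).
Proof. by []. Qed.

(* The rules of [evalE] must be exhausted before those of [linE] are used: the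
   value [(f *: Y) g] is convertible to a product, so that [vfM] would match
   [X ((f *: Y) g)] and leave a term in which [Y] is unfolded. *)
Let evalE := (one_formDE, one_formNE, one_formZE, dfunE, lie_derivativeE,
  vfDE, vfZE, vfNE, lie_bracketE).
Let linE := (vfD, vfN, vfH, vfM, one_formD, one_formN, one_formZ).

Lemma lie_bracketC (X Y : vector_field M) : lie_bracket Y X = - lie_bracket X Y.
Proof. by apply: vf_eqP => f; rewrite ?evalE ?linE; ring. Qed.

Lemma lie_bracketDl (X Y Z : vector_field M) :
  lie_bracket (X + Y) Z = lie_bracket X Z + lie_bracket Y Z.
Proof. by apply: vf_eqP => f; rewrite ?evalE ?linE; ring. Qed.

Lemma lie_bracketDr (X Y Z : vector_field M) :
  lie_bracket Z (X + Y) = lie_bracket Z X + lie_bracket Z Y.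
Proof. by apply: vf_eqP => f; rewrite ?evalE ?linE; ring. Qed.

Lemma lie_bracket_jacobi (X Y Z : vector_field M) :
  lie_bracket X (lie_bracket Y Z) =
  lie_bracket (lie_bracket X Y) Z + lie_bracket Y (lie_bracket X Z).
Proof. by apply: vf_eqP => f; rewrite ?evalE ?linE; ring. Qed.

Lemma lie_bracketZ (X Y : vector_field M) (f : C) :
  lie_bracket X (f *: Y) = f *: lie_bracket X Y + X f *: Y.
Proof. by apply: vf_eqP => g; rewrite ?evalE ?linE; ring. Qed.

Lemma gsection_eq (e e' : E) : e.1 = e'.1 -> e.2 = e'.2 -> e = e'.
Proof. by case: e e' => [? ?] [? ?] /= -> ->. Qed.

Lemma smooth_halfD : half + half = 1.
Proof.
apply/val_inj/funext => x.
by rewrite -[LHS]/(2^-1 + 2^-1 : R) -[RHS]/(1 : R) [RHS]splitr div1r.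
Qed.

Lemma smooth_half_eq0 (f : C) : half * f = 0 -> f = 0.
Proof. by move=> h; rewrite -[f]mul1r -smooth_halfD mulrDl h addr0. Qed.

(** The Dorfman bracket
    [X + a ∘ Y + b = [X, Y] + L_X b - i_Y (d a)], with [- i_Y (d a)] expanded by
    the formula of Cartan as [- L_Y a + d (a Y)]. *)
Definition dorfman (e e' : E) : E :=
  (lie_bracket e.1 e'.1,
   lie_derivative e.1 e'.2 - lie_derivative e'.1 e.2 + dfun (e.2 e'.1)).

(** The differential of a function, as a section of [TM + T*M]. *)
Definition exact_section (f : C) : E := (0, dfun f).

(** The derivative of a function along the vector part of a section. *)
Definition anchor_action (e : E) (f : C) : C := e.1 f.

Lemma dorfman_courant e e' :
  dorfman e e' = courant e e' + exact_section (pairing e e').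
Proof.
apply: gsection_eq; first by rewrite /= addr0.
apply: one_form_eqP => X; rewrite /= /pairing ?evalE ?linE.
rewrite -[X (e.2 e'.1) in LHS]mul1r -smooth_halfD.
by ring.
Qed.

Lemma pairing_exact f e :
  pairing (exact_section f) e + pairing (exact_section f) e = anchor_action e f.
Proof.
by rewrite /pairing /= one_form0 ?evalE ?linE -mulrDl smooth_halfD add0r mul1r.
Qed.

Lemma exact_sectionD : {morph exact_section : f g / f + g}.
Proof.
move=> f g; apply: gsection_eq; first by rewrite /= addr0.
by apply: one_form_eqP => X; rewrite /= ?evalE ?linE.
Qed.

Lemma pairing_sym (e e' : E) : pairing e e' = pairing e' e.
Proof. by rewrite /pairing addrC. Qed.

Lemma courantC (e e' : E) : courant e e' = - courant e' e.
Proof.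
apply: gsection_eq; first exact: lie_bracketC.
by apply: one_form_eqP => X; rewrite /= ?evalE ?linE; ring.
Qed.

Lemma pairing_biadditive : biadditive (@pairing R n M).
Proof. by split=> [v x y|u x y]; rewrite /pairing /= ?evalE ?linE; ring. Qed.

Lemma anchor_action_biadditive : biadditive anchor_action.
Proof. by split=> [v x y|u x y]; rewrite /anchor_action /= ?evalE ?linE. Qed.

Lemma scale_biadditive : biadditive (fun (f : C) (e : E) => f *: e).
Proof. by split=> [v x y|u x y]; rewrite (scalerDl, scalerDr). Qed.

Lemma dorfman_biadditive : biadditive dorfman.
Proof.
split=> [v x y|u x y]; apply: gsection_eq; rewrite /= ?lie_bracketDl ?lie_bracketDr //.
  by apply: one_form_eqP => X; rewrite /= ?evalE ?(lie_bracketDl, lie_bracketDr) ?linE; ring.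
by apply: one_form_eqP => X; rewrite /= ?evalE ?(lie_bracketDl, lie_bracketDr) ?linE; ring.
Qed.

Lemma dorfman_jacobi e1 e2 e3 :
  dorfman e1 (dorfman e2 e3) =
  dorfman (dorfman e1 e2) e3 + dorfman e2 (dorfman e1 e3).
Proof.
apply: gsection_eq; first exact: lie_bracket_jacobi.
apply: one_form_eqP => X; rewrite /= ?evalE ?linE.
rewrite (lie_bracket_jacobi e1.1 e2.1) (lie_bracket_jacobi e3.1 e1.1)
  (lie_bracket_jacobi e3.1 e2.1) ?evalE ?linE.
rewrite (lie_bracketC e2.1 e3.1) (lie_bracketC e1.1 e3.1).
have bNl (Y Z : vector_field M) : lie_bracket (- Y) Z = - lie_bracket Y Z.
  by apply: vf_eqP => f; rewrite ?evalE ?linE; ring.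
rewrite !bNl ?evalE ?linE.
by ring.
Qed.

Lemma pairing_invariant e e1 e2 :
  anchor_action e (pairing e1 e2) =
  pairing (dorfman e e1) e2 + pairing e1 (dorfman e e2).
Proof.
rewrite /anchor_action /pairing /= ?evalE ?linE.
rewrite (lie_bracketC e1.1 e2.1) ?linE.
by ring.
Qed.

Lemma dorfman_leibniz e (f : C) e' :
  dorfman e (f *: e') = anchor_action e f *: e' + f *: dorfman e e'.
Proof.
apply: gsection_eq; first by rewrite /= lie_bracketZ addrC.
apply: one_form_eqP => X; rewrite /anchor_action /= ?evalE ?linE.
rewrite (lie_bracketC X (f *: _)) lie_bracketZ (lie_bracketC X e'.1) ?evalE ?linE.
by ring.
Qed.

Lemma pairingZ (e : E) (f : C) (e' : E) : pairing e (f *: e') = f * pairing e e'.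
Proof. by rewrite /pairing /= ?evalE ?linE; ring. Qed.

(** A section is detected by the pairing with the sections [(X, 0)], which see
    its form, and [(0, df)], which see its vector field. *)
Lemma pairing_nondegenerate (e : E) : (forall e', pairing e e' = 0) -> e = 0.
Proof.
move=> e0; apply: gsection_eq.
  apply: vf_eqP => f; apply: smooth_half_eq0.
  by have := e0 (0, dfun f); rewrite /pairing /= one_form0 addr0.
apply: one_form_eqP => X; apply: smooth_half_eq0.
by have := e0 (X, 0); rewrite /pairing /= one_form0E add0r.
Qed.
End Real.

(** * The complexified Dorfman bracket *)

Section ComplexDorfman.
Variables (R : realType) (n : nat) (M : smooth_manifold R n).
Local Notation C := (C^oo M).
Local Notation E := (gsection M).
Local Notation "'rho' u" := (vf_action (anchor u)) (at level 10, u at level 9).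
Local Notation "<< u , v >>" := (cpairing u v).
Local Notation "⟦ u , v ⟧" := (ccourant u v).

Implicit Types (u v w x y : E^cplx) (A B : set E^cplx).

(** The complex-bilinear extension of the Dorfman bracket. *)
Definition cdorfman : E^cplx -> E^cplx -> E^cplx := bilinC (@dorfman R n M).
(** The complex-linear extension of [exact_section]. *)
Definition cexact : C^cplx -> E^cplx := linC (@exact_section R n M).

Local Notation "u ∘ v" := (cdorfman u v) (at level 40, left associativity).

Lemma exact_sectionN (f : C) : exact_section (- f) = - exact_section f.
Proof. exact: (morphDN (@exact_sectionD R n M)). Qed.

Lemma cexactD : {morph cexact : f g / f + g}.
Proof. by move=> f g; apply: cplx_eq; exact: exact_sectionD. Qed.

Lemma cexact0 : cexact 0 = 0.
Proof. exact: morphD0 cexactD. Qed.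

Lemma cdorfman_ccourant u v : u ∘ v = ⟦u, v⟧ + cexact <<u, v>>.
Proof.
apply: cplx_eq; rewrite /= !dorfman_courant exact_sectionD ?exact_sectionN ?opprD.
all: exact: addrACA.
Qed.

Lemma cpairingC u v : <<u, v>> = <<v, u>>.
Proof.
rewrite /cpairing /bilinC (pairing_sym u.1) (pairing_sym u.2 v.2).
by rewrite (pairing_sym u.1) (pairing_sym u.2) [_ + pairing v.2 _]addrC.
Qed.

Lemma ccourantC u v : ⟦u, v⟧ = - ⟦v, u⟧.
Proof.
apply: cplx_eq; rewrite /= (courantC u.1) (courantC u.2).
  by rewrite opprD.
by rewrite opprD addrC.
Qed.

Lemma cdorfmanC u v : u ∘ v + v ∘ u = cexact (<<u, v>> + <<u, v>>).
Proof.
rewrite !cdorfman_ccourant ccourantC (cpairingC v) cexactD.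
by rewrite addrACA addNr add0r.
Qed.

Lemma cpairing_biadditive : biadditive (@cpairing R n M).
Proof. exact/bilinC_biadditive/pairing_biadditive. Qed.

Lemma cdorfman_biadditive : biadditive cdorfman.
Proof. exact/bilinC_biadditive/dorfman_biadditive. Qed.

Lemma cpairingDl u v w : <<u + v, w>> = <<u, w>> + <<v, w>>.
Proof. exact: cpairing_biadditive.1. Qed.
Lemma cpairingDr u v w : <<w, u + v>> = <<w, u>> + <<w, v>>.
Proof. exact: cpairing_biadditive.2. Qed.
Lemma cpairingBl u v w : <<u - v, w>> = <<u, w>> - <<v, w>>.
Proof. exact: biadditiveBl cpairing_biadditive _ _ _. Qed.
Lemma cpairingBr u v w : <<w, u - v>> = <<w, u>> - <<w, v>>.
Proof. exact: biadditiveBr cpairing_biadditive _ _ _. Qed.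
Lemma cpairingNl u w : <<- u, w>> = - <<u, w>>.
Proof. exact: biadditiveNl cpairing_biadditive _ _. Qed.

Lemma cpairingZr u (f : C^cplx) v : <<u, f *: v>> = f * <<u, v>>.
Proof.
(* Linearity is a derivation identity whose first term is zero. *)
pose z (_ : C) (_ : E) : C := 0.
have zA : biadditive z by split=> [b e e'|b e e']; rewrite /z addr0.
have mA : biadditive ( *%R : C -> C -> C).
  by split=> [a b c|a b c]; rewrite (mulrDl, mulrDr).
pose k (_ : E) (f : C) : C := f.
have zE : bilinC z (bilinC k u f) v = 0 by apply: cplx_eq; rewrite /= ?subrr ?addr0.
rewrite -[RHS]add0r -zE.
apply: (bilinC_derivation (pairing_biadditive M) zA mA) => e g e'.
by rewrite add0r pairingZ.
Qed.

Lemma cpairingZl u (f : C^cplx) v : <<f *: u, v>> = f * <<u, v>>.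
Proof. by rewrite cpairingC cpairingZr cpairingC. Qed.

Lemma cpairing_exact (f : C^cplx) u : <<cexact f, u>> + <<cexact f, u>> = rho u f.
Proof.
apply: cplx_eq; rewrite /= addrACA.
  by rewrite -opprD !pairing_exact.
by rewrite !pairing_exact addrC.
Qed.

Lemma cpairing_invariant u v w : rho u <<v, w>> = <<u ∘ v, w>> + <<v, u ∘ w>>.
Proof.
exact: (bilinC_derivation (anchor_action_biadditive M)
  (pairing_biadditive M) (pairing_biadditive M) (@pairing_invariant R n M)).
Qed.

Lemma cdorfman_jacobi u v w : u ∘ (v ∘ w) = u ∘ v ∘ w + v ∘ (u ∘ w).
Proof.
exact: (bilinC_derivation (dorfman_biadditive M)
  (dorfman_biadditive M) (dorfman_biadditive M) (@dorfman_jacobi R n M)).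
Qed.

Lemma cdorfman_leibniz u (f : C^cplx) v :
  u ∘ (f *: v) = (rho u f) *: v + f *: (u ∘ v).
Proof.
exact: (bilinC_derivation (dorfman_biadditive M)
  (scale_biadditive M) (scale_biadditive M) (@dorfman_leibniz R n M)).
Qed.

Lemma rho0 u : rho u 0 = 0.
Proof. exact: morphD0 ((bilinC_biadditive (anchor_action_biadditive M)).2 u). Qed.

Lemma cpairing_of_real u (e : E) :
  <<u, of_real e>> = (pairing u.1 e, pairing u.2 e).
Proof.
have p0 (e' : E) : pairing e' 0 = 0.
  exact: morphD0 ((pairing_biadditive M).2 e').
by apply: cplx_eq; rewrite /= p0 ?subr0 ?add0r.
Qed.

Lemma cpairing_nondegenerate u : (forall v, <<u, v>> = 0) -> u = 0.
Proof.
move=> u0; apply: cplx_eq; apply: pairing_nondegenerate => e.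
  by have := congr1 fst (u0 (of_real e)); rewrite cpairing_of_real.
by have := congr1 snd (u0 (of_real e)); rewrite cpairing_of_real.
Qed.

(** * Transverse isotropic submodules *)

(** Submodules of [(TM + T*M) (x) C] over the complex-valued smooth functions. *)
Definition cplx_submodule (A : set E^cplx) : Prop :=
  A 0 /\ forall (f : C^cplx) u v, A u -> A v -> A (f *: u + v).

(** The pairing vanishes on [A]. *)
Definition isotropic (A : set E^cplx) : Prop :=
  forall u v, A u -> A v -> <<u, v>> = 0.

Lemma isotropic_ccourant (A : set E^cplx) u v :
  isotropic A -> A u -> A v -> ⟦u, v⟧ = u ∘ v.
Proof.
by move=> iA Au Av; rewrite cdorfman_ccourant (iA u v) // cexact0 addr0.
Qed.

Lemma isotropic_cdorfmanC (A : set E^cplx) u v :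
  isotropic A -> A u -> A v -> v ∘ u = - (u ∘ v).
Proof.
by move=> iA Au Av; rewrite -!(isotropic_ccourant iA) // ccourantC.
Qed.

Lemma isotropic_lie_algebroid (A : set E^cplx) :
  cplx_submodule A -> isotropic A -> courant_closed A -> lie_algebroid A.
Proof.
move=> [A0 AZD] iA cA; split=> //; split.
- by move=> u v _ _; exact: ccourantC.
- move=> u v w Au Av Aw.
  rewrite !(isotropic_ccourant iA) //; try by rewrite -(isotropic_ccourant iA) //; apply: cA.
  rewrite (isotropic_cdorfmanC iA Au Aw).
  rewrite (@isotropic_cdorfmanC A (u ∘ v) w) //; last first.
    by rewrite -(isotropic_ccourant iA) //; apply: cA.
  rewrite (biadditiveNr cdorfman_biadditive) (cdorfman_jacobi u v w).
  by rewrite addrK subrr.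
- move=> f u v Au Av; have Afv : A (f *: v) by rewrite -[_ *: _]addr0; apply: AZD.
  by rewrite !(isotropic_ccourant iA) // cdorfman_leibniz addrC.
Qed.

(** [A] and [B] together span; for isotropic [A] and [B] the sum is then
    direct, by [transverse_dual]. *)
Definition complementary (A B : set E^cplx) : Prop :=
  forall u, exists a b, [/\ A a, B b & u = a + b].

Lemma complementaryC A B : complementary A B -> complementary B A.
Proof.
move=> cAB u; have [a [b [Aa Bb ->]]] := cAB u.
by exists b, a; rewrite addrC.
Qed.

Section Transverse.
Variables (A B : set E^cplx).
Hypotheses (iA : isotropic A) (iB : isotropic B) (cAB : complementary A B).

Lemma transverse_dual u : B u -> (forall a, A a -> <<u, a>> = 0) -> u = 0.
Proof.
move=> Bu uA; apply: cpairing_nondegenerate => v.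
have [a [b [Aa Bb ->]]] := cAB v.
by rewrite cpairingDr uA // iB // addr0.
Qed.

(** The orthogonal of [A] is contained in [A]: [A] is maximal isotropic. *)
Lemma transverse_orthogonal u : (forall a, A a -> <<u, a>> = 0) -> A u.
Proof.
move=> uA; have [a [b [Aa Bb ue]]] := cAB u.
suff -> : u = a by [].
rewrite ue (transverse_dual Bb) ?addr0 // => a' Aa'.
by have := uA _ Aa'; rewrite ue cpairingDl iA // add0r.
Qed.

Hypothesis closedA : courant_closed A.

Lemma closed_cdorfman u v : A u -> A v -> A (u ∘ v).
Proof. by move=> Au Av; rewrite -(isotropic_ccourant iA Au Av); apply: closedA. Qed.

(** The Lie derivative of [x] along [u] is the [B]-component of [u ∘ x]; in
    particular the section chosen in its definition does exist. *)
Lemma dual_lie_derivativeP u x : A u -> B x ->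
  B (dual_lie_derivative A B u x) /\ A (u ∘ x - dual_lie_derivative A B u x).
Proof.
move=> Au Bx.
have lieE v : A v -> rho u <<v, x>> - <<⟦u, v⟧, x>> = <<v, u ∘ x>>.
  move=> Av; rewrite (isotropic_ccourant iA) // cpairing_invariant.
  by rewrite addrC addKr.
have [b Bb uxb] : exists2 y, B y & forall v, A v ->
    <<v, y>> = rho u <<v, x>> - <<⟦u, v⟧, x>>.
  have [a [b [Aa Bb uxe]]] := cAB (u ∘ x).
  exists b => // v Av; by rewrite lieE // uxe cpairingDr (iA Av Aa) add0r.
have [By yP] : B (dual_lie_derivative A B u x) /\ forall v, A v ->
    <<v, dual_lie_derivative A B u x>> = rho u <<v, x>> - <<⟦u, v⟧, x>>.
  by rewrite /dual_lie_derivative; case: xgetP => [y _ //|/(_ b)[]].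
split=> //; apply: transverse_orthogonal => v Av.
by rewrite cpairingC cpairingBr -lieE // [X in _ - X]yP // subrr.
Qed.

Lemma algebroid_dE u x y : B x -> B y -> algebroid_d u x y = - <<u ∘ x, y>>.
Proof.
move=> Bx By; rewrite /algebroid_d (isotropic_ccourant iB) // cpairing_invariant.
rewrite -cpairing_exact -cpairingDl -cexactD -cdorfmanC cpairingDl.
ring.
Qed.

(** The two correction terms come from the [A]-components
    [u ∘ x - dual_lie_derivative A B u x] of the brackets [u ∘ x] and [u ∘ y]. *)
Lemma schouten12_dE u v x y : A u -> A v -> B x -> B y ->
  schouten12 A B u (algebroid_d v) x y =
  - <<u ∘ v ∘ x, y>>
  - <<v ∘ (u ∘ x - dual_lie_derivative A B u x), y>>
  - <<dual_lie_derivative A B v x, u ∘ y - dual_lie_derivative A B u y>>.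
Proof.
move=> Au Av Bx By.
have [BLx ALx] := dual_lie_derivativeP Au Bx.
have [BLy ALy] := dual_lie_derivativeP Au By.
have [BLv ALv] := dual_lie_derivativeP Av Bx.
rewrite /schouten12 !algebroid_dE //.
have rhoN f : rho u (- f) = - rho u f.
  exact: morphDN ((bilinC_biadditive (anchor_action_biadditive M)).2 u) _.
rewrite rhoN cpairing_invariant cdorfman_jacobi cpairingDl.
rewrite (biadditiveBr cdorfman_biadditive) cpairingBl.
(* In the pairing with an element of [A], [v ∘ x] can be replaced by its
   [B]-component, since [A] is isotropic. *)
have := iA ALv ALy; rewrite cpairingBl => /subr0_eq <-.
rewrite cpairingBr; ring.
Qed.

(** The compatibility condition of a Lie bialgebroid: after [schouten12_dE] it is
    the Jacobi identity for [u], [v], [x], paired with [y]. *)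
Lemma transverse_compatibility u v x y : A u -> A v -> B x -> B y ->
  algebroid_d ⟦u, v⟧ x y =
  schouten21 A B (algebroid_d u) v x y + schouten12 A B u (algebroid_d v) x y.
Proof.
move=> Au Av Bx By.
rewrite (isotropic_ccourant iA) // algebroid_dE // /schouten21 !schouten12_dE //.
have [BLx ALx] := dual_lie_derivativeP Au Bx.
have [BLy ALy] := dual_lie_derivativeP Au By.
have [BLvx ALvx] := dual_lie_derivativeP Av Bx.
have [BLvy ALvy] := dual_lie_derivativeP Av By.
set a := _ - dual_lie_derivative A B u x.
set a' := _ - dual_lie_derivative A B v x.
rewrite (isotropic_cdorfmanC iA Au Av).
(* As [B] is isotropic, the bracket with [w] is skew for the pairing on [B]. *)
have invB w z : B z -> <<z, w ∘ y>> = - <<w ∘ z, y>>.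
  move=> Bz; have := cpairing_invariant w z y; rewrite (iB Bz By) rho0.
  by move/esym/eqP; rewrite addrC addr_eq0 => /eqP.
rewrite !cpairingBr (iB BLvx BLy) (iB BLx BLvy) !subr0 !invB //.
rewrite (biadditiveNl cdorfman_biadditive) cpairingNl.
have := cdorfman_jacobi u v x => /(congr1 (fun z => <<z, y>>)).
rewrite cpairingDl.
have -> : v ∘ x = a' + dual_lie_derivative A B v x by rewrite /a' subrK.
have -> : u ∘ x = a + dual_lie_derivative A B u x by rewrite /a subrK.
rewrite !(cdorfman_biadditive.2) !cpairingDl => /eqP.
rewrite -subr_eq => /eqP <-; ring.
Qed.

End Transverse.

(** The theorem of Liu, Weinstein and Xu for transverse isotropic submodules. *)
Lemma transverse_lie_bialgebroid A B :
  cplx_submodule A -> cplx_submodule B -> isotropic A -> isotropic B ->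
  complementary A B ->
  lie_bialgebroid A B <-> courant_closed A /\ courant_closed B.
Proof.
move=> mA mB iA iB cAB; split=> [[_ [_ _ cA _] [_ _ cB _] _]|[cA cB]].
  by split.
split; [|exact: isotropic_lie_algebroid..|]; last first.
  by move=> u v Au Av x y Bx By; exact: transverse_compatibility.
split=> [u Au uB|x Bx xA].
  exact: (transverse_dual iA (complementaryC cAB) Au).
apply: (transverse_dual iB cAB Bx) => a Aa.
by rewrite cpairingC xA.
Qed.

End ComplexDorfman.

(** * Complex conjugation *)

Section Conjugation.

(** Complex conjugation on a complexification. *)
Definition conjC (V : zmodType) (u : V^cplx) : V^cplx := (u.1, - u.2).

Lemma conjCK (V : zmodType) : involutive (@conjC V).
Proof. by move=> u; apply: cplx_eq; rewrite /= ?opprK. Qed.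

Lemma bilinC_conj (U V W : zmodType) (f : U -> V -> W) : biadditive f ->
  forall u v, bilinC f (conjC u) (conjC v) = conjC (bilinC f u v).
Proof.
move=> fA u v; apply: cplx_eq; rewrite /= !(biadditiveNr fA) !(biadditiveNl fA).
  by rewrite opprK.
by rewrite opprD.
Qed.
End Conjugation.

(** * The bundles of a generalized almost contact structure *)

Section ContactBundles.
Variables (R : realType) (n : nat) (M : smooth_manifold R n) (J : gac_pair M).
Local Notation C := (C^oo M).
Local Notation E := (gsection M).
Local Notation Phi := (gac_Phi J).
Local Notation F := (gac_F J).
Local Notation eta := (gac_eta J).
Local Notation half := (smooth_half M).
Local Notation "'rho' u" := (vf_action (anchor u)) (at level 10, u at level 9).
Local Notation "<< u , v >>" := (cpairing u v).
Local Notation "u ∘ v" := (cdorfman u v) (at level 40, left associativity).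
Local Notation FC := (of_real ((F, 0) : E) : E^cplx).
Local Notation etaC := (of_real ((0, eta) : E) : E^cplx).
Implicit Types (e : E) (u v w x y : E^cplx) (A B : set E^cplx).

Lemma pairing_F e : pairing e (F, 0) = half * e.2 F.
Proof. by rewrite /pairing /= one_form0E add0r. Qed.

Lemma pairing_eta e : pairing e (0, eta) = half * eta e.1.
Proof. by rewrite /pairing /= one_form0 addr0. Qed.

Lemma ker_eta_FZD (f : C) e e' : ker_eta_F J e -> ker_eta_F J e' ->
  ker_eta_F J (f *: e + e').
Proof.
move=> [e1 e2] [e1' e2']; split=> /=.
  by rewrite one_formD one_formZ e1 e1' mulr0 addr0.
by rewrite one_formDE one_formZE e2 e2' mulr0 addr0.
Qed.

Lemma ker_eta_F0 : ker_eta_F J 0.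
Proof. by split; rewrite /= ?one_form0 ?one_form0E. Qed.

Lemma ker_eta_FZ (f : C) e : ker_eta_F J e -> ker_eta_F J (f *: e).
Proof. by move=> ke; rewrite -[f *: e]addr0; apply/ker_eta_FZD/ker_eta_F0. Qed.

Lemma ker_eta_FD e e' : ker_eta_F J e -> ker_eta_F J e' -> ker_eta_F J (e + e').
Proof. by move=> ke ke'; rewrite -[e]scale1r; apply: ker_eta_FZD. Qed.

Lemma ker_eta_FN e : ker_eta_F J e -> ker_eta_F J (- e).
Proof. by move=> ke; rewrite -scaleN1r; apply: ker_eta_FZ. Qed.

Lemma ker_eta_F_Phi e : ker_eta_F J (Phi e).
Proof.
have p0 : pairing e 0 = 0 by exact: morphD0 ((pairing_biadditive M).2 e).
split; apply: smooth_half_eq0.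
  have := gac_skew J e (0, eta).
  by rewrite gac_Phi_eta p0 addr0 pairing_eta.
have := gac_skew J e (F, 0).
by rewrite gac_Phi_F p0 addr0 pairing_F.
Qed.

Lemma Phi_sqr_ker e : ker_eta_F J e -> Phi (Phi e) = - e.
Proof.
move=> [e1 e2]; rewrite gac_Phi_sqr e1 e2 !scale0r.
by rewrite -[(0, 0)]/(0 : E) addr0.
Qed.

Lemma pairing_Phi e e' : ker_eta_F J e' -> pairing (Phi e) (Phi e') = pairing e e'.
Proof.
move=> ke'; have := gac_skew J e (Phi e'); rewrite Phi_sqr_ker //.
rewrite (biadditiveNr (pairing_biadditive M)) => /eqP.
by rewrite subr_eq0 => /eqP.
Qed.

Lemma E10_conj u : E10 J u -> E01 J (conjC u).
Proof. by move=> [e ke <-]; exists e => //; rewrite /conjC /= opprK. Qed.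

Lemma E01_conj u : E01 J u -> E10 J (conjC u).
Proof. by move=> [e ke <-]; exists e. Qed.

Lemma E10_submodule : cplx_submodule (E10 J).
Proof.
split; first by exists 0; [exact: ker_eta_F0|rewrite linear0 oppr0].
move=> [a b] _ _ [e ke <-] [e' ke' <-].
exists (a *: e + (b *: Phi e + e')).
  by apply: ker_eta_FZD => //; apply: ker_eta_FZD => //; exact: ker_eta_F_Phi.
apply: cplx_eq => /=.
  by rewrite scalerN opprK addrA.
rewrite !linearP Phi_sqr_ker // !scalerN opprK.
exact: addrA.
Qed.

Lemma E01_submodule : cplx_submodule (E01 J).
Proof.
have [E0 EZD] := E10_submodule; split.
  by have := E10_conj E0; rewrite /conjC /= oppr0.
move=> f u v /E01_conj Eu /E01_conj Ev; rewrite -[_ + _]conjCK; apply: E10_conj.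
have -> : conjC (f *: u + v) = conjC f *: conjC u + conjC v.
  have := bilinC_conj (scale_biadditive M) f u => /= H.
  rewrite [conjC f *: conjC u]H.
  by apply: cplx_eq; rewrite /= ?opprD.
exact: EZD.
Qed.

Lemma cpairing_conj u v : <<conjC u, conjC v>> = conjC <<u, v>>.
Proof. exact: bilinC_conj (pairing_biadditive M) u v. Qed.

Lemma conjC0 (V : zmodType) : conjC (0 : V^cplx) = 0.
Proof. by apply: cplx_eq; rewrite /= ?oppr0. Qed.

Lemma E10_isotropic : isotropic (E10 J).
Proof.
move=> _ _ [e ke <-] [e' ke' <-]; have pA := pairing_biadditive M.
apply: cplx_eq; rewrite /= !(biadditiveNr pA) !(biadditiveNl pA).
  by rewrite opprK pairing_Phi // subrr.
by rewrite -opprD addrC gac_skew oppr0.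
Qed.

Lemma E01_isotropic : isotropic (E01 J).
Proof.
move=> u v /E01_conj Eu /E01_conj Ev; rewrite -[LHS]conjCK -cpairing_conj.
by rewrite E10_isotropic ?conjC0.
Qed.

(** The sum of the line spanned by [l] and of [A]; [gac_L J] and [gac_Lstar J]
    are instances by definition. *)
Definition line_plus (l : E^cplx) A : set E^cplx :=
  [set u | exists (f : C^cplx) w, A w /\ u = f *: l + w]%classic.

Lemma line_plus_submodule l A : cplx_submodule A -> cplx_submodule (line_plus l A).
Proof.
move=> [A0 AZD]; split; first by exists 0, 0; rewrite scale0r addr0.
move=> f _ _ [g [w [Aw ->]]] [g' [w' [Aw' ->]]].
exists (f * g + g'), (f *: w + w'); split; first exact: AZD.
by rewrite scalerDr scalerDl scalerA addrACA.
Qed.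

Lemma line_plus_isotropic l A : isotropic A -> << l, l>> = 0 ->
  (forall w, A w -> << l, w>> = 0) -> isotropic (line_plus l A).
Proof.
move=> iA ll lA _ _ [g [w [Aw ->]]] [g' [w' [Aw' ->]]].
rewrite !cpairingDl !cpairingDr !cpairingZl !cpairingZr ll !lA //.
by rewrite cpairingC lA // iA // !mulr0 !addr0.
Qed.

Lemma line_plus_sub l A w : A w -> line_plus l A w.
Proof. by move=> Aw; exists 0, w; rewrite scale0r add0r. Qed.

(** [F] is orthogonal to the sections whose form parts vanish on [F]. *)
Lemma FC_ker u : (u.1).2 F = 0 -> (u.2).2 F = 0 -> <<FC, u>> = 0.
Proof.
move=> u1 u2; rewrite cpairingC cpairing_of_real !pairing_F u1 u2.
by rewrite mulr0.
Qed.

(** [eta] is orthogonal to the sections whose vector parts lie in its kernel. *)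
Lemma etaC_ker u : eta (u.1).1 = 0 -> eta (u.2).1 = 0 -> <<etaC, u>> = 0.
Proof.
move=> u1 u2; rewrite cpairingC cpairing_of_real !pairing_eta u1 u2.
by rewrite mulr0.
Qed.

Lemma E01_ker u : E01 J u -> ker_eta_F J u.1 /\ ker_eta_F J u.2.
Proof. by move=> [e ke <-]; split=> //; exact: ker_eta_F_Phi. Qed.

Lemma E10_ker u : E10 J u -> ker_eta_F J u.1 /\ ker_eta_F J u.2.
Proof. by move=> [e ke <-]; split=> //; apply/ker_eta_FN/ker_eta_F_Phi. Qed.

Lemma gac_L_submodule : cplx_submodule (gac_L J).
Proof. exact: line_plus_submodule E10_submodule. Qed.

Lemma gac_Lstar_submodule : cplx_submodule (gac_Lstar J).
Proof. exact: line_plus_submodule E01_submodule. Qed.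

Lemma gac_L_isotropic : isotropic (gac_L J).
Proof.
apply: line_plus_isotropic E10_isotropic _ _.
  by apply: FC_ker; exact: one_form0E.
by move=> w /E10_ker[[_ w1] [_ w2]]; apply: FC_ker.
Qed.

Lemma gac_Lstar_isotropic : isotropic (gac_Lstar J).
Proof.
apply: line_plus_isotropic E01_isotropic _ _.
  by apply: etaC_ker; exact: one_form0.
by move=> w /E01_ker[[w1 _] [w2 _]]; apply: etaC_ker.
Qed.

Lemma gac_complementary : complementary (gac_L J) (gac_Lstar J).
Proof.
(* [k e] is the component of [e] in [ker eta + ker F]. *)
pose k e : E := e - ((eta e.1 *: F, e.2 F *: eta) : E).
have kk e : ker_eta_F J (k e).
  split; rewrite /k /=.
    by rewrite one_formD one_formN one_formZ gac_eta_F mulr1 subrr.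
  by rewrite one_formDE one_formNE one_formZE gac_eta_F mulr1 subrr.
(* The component [w] of [u] in [ker eta + ker F] is the sum of its eigenparts
   [(w - i Phi w) / 2] and [(w + i Phi w) / 2], whose real parts are [p] and [q]. *)
move=> u; pose p : E := half *: (k u.1 + Phi (k u.2)).
pose q : E := half *: (k u.1 - Phi (k u.2)).
have halfE e : half *: e + half *: e = e.
  by rewrite -scalerDl smooth_halfD scale1r.
pose f : C^cplx := (eta (u.1).1, eta (u.2).1).
pose g : C^cplx := ((u.1).2 F, (u.2).2 F).
exists (f *: FC + add_i p (- Phi p)).
exists (g *: etaC + add_i q (Phi q)); split.
- exists f, (add_i p (- Phi p)); split=> //; exists p => //.
  apply/ker_eta_FZ/ker_eta_FD; [exact: kk|exact: ker_eta_F_Phi].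
- exists g, (add_i q (Phi q)); split=> //; exists q => //.
  apply/ker_eta_FZ/ker_eta_FD; [exact: kk|apply/ker_eta_FN; exact: ker_eta_F_Phi].
have decE e : e = (eta e.1 *: ((F, 0) : E) + e.2 F *: ((0, eta) : E)) + k e.
  rewrite /k addrC -addrA -[LHS]addr0; congr (_ + _).
  by apply: gsection_eq; rewrite /= scaler0 ?add0r ?addr0 addNr.
have pq : p + q = k u.1.
  by rewrite /p /q -scalerDr addrACA subrr addr0 scalerDr halfE.
have Ppq : Phi q - Phi p = k u.2.
  rewrite -linearB /p /q -scalerBr opprD addrACA subrr add0r -opprD scalerN.
  by rewrite scalerDr halfE linearN Phi_sqr_ker // opprK.
apply: cplx_eq; rewrite /= !scaler0 ?subr0 ?add0r.
  by rewrite [LHS]decE -pq addrACA.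
by rewrite [LHS]decE -Ppq [in RHS]addrACA [Phi q - _]addrC.
Qed.

Lemma double_eq0 (f : C^cplx) : f + f = 0 -> f = 0.
Proof.
move=> ff; have half0 (g : C) : g + g = 0 -> g = 0.
  by move=> gg; rewrite -[g]mul1r -smooth_halfD mulrDl -mulrDr gg mulr0.
by apply: cplx_eq; apply: half0; [have := congr1 fst ff|have := congr1 snd ff].
Qed.

(** When [eta] vanishes on the anchors of [u] and [v], only the term
    [- eta [rho u, rho v]] of [d eta] remains; the pairing with [eta] gives half
    of it. *)
Lemma rho_d_etaE u v : eta (u.1).1 = 0 -> eta (u.2).1 = 0 ->
  eta (v.1).1 = 0 -> eta (v.2).1 = 0 ->
  rho_d_eta J u v = - (<<u ∘ v, etaC>> + <<u ∘ v, etaC>>).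
Proof.
have X0 (X : vector_field M) : X 0 = 0.
  by apply: (morphD0 (f := X : C -> C)) => ? ?; exact: vfD.
have dE (X Y : vector_field M) : eta X = 0 -> eta Y = 0 ->
    exterior_d eta X Y = - eta (lie_bracket X Y).
  by move=> hX hY; rewrite /exterior_d hX hY !X0 subrr add0r.
move=> u1 u2 v1 v2; rewrite cpairing_of_real !pairing_eta.
have hE (f : C) : half * f + half * f = f.
  by rewrite -mulrDl smooth_halfD mul1r.
apply: cplx_eq; rewrite /= hE !dE // ?one_formD ?one_formN ?opprD //.
Qed.

(** The (2,0) and (0,2) parts of [d eta] are conjugate, so one of the two
    conditions suffices. *)
Lemma d_eta_type11E : d_eta_type11 J <->
  (forall u v, E01 J u -> E01 J v -> <<u ∘ v, etaC>> = 0).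
Proof.
have dE u v : E01 J u -> E01 J v ->
    rho_d_eta J u v = - (<<u ∘ v, etaC>> + <<u ∘ v, etaC>>).
  by move=> /E01_ker[[u1 _] [u2 _]] /E01_ker[[v1 _] [v2 _]]; apply: rho_d_etaE.
split=> [[d20 _] u v Eu Ev|d0].
  by apply/double_eq0/eqP; rewrite -oppr_eq0 -dE // d20.
split=> u v Eu Ev; first by rewrite dE // d0 // addr0 oppr0.
have [[[u1 _] [u2 _]] [[v1 _] [v2 _]]] := (E10_ker Eu, E10_ker Ev).
rewrite rho_d_etaE //.
suff -> : <<u ∘ v, etaC>> = 0 by rewrite addr0 oppr0.
have etaCE : etaC = conjC etaC by rewrite /conjC /= oppr0.
rewrite -[u]conjCK -[v]conjCK /cdorfman (bilinC_conj (dorfman_biadditive M)).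
by rewrite etaCE cpairing_conj d0 ?conjC0 //; apply: E10_conj.
Qed.

(** The pairing of a bracket with [eta] depends on the anchors only. *)
Lemma cdorfman_eta u v : <<u ∘ v, etaC>> =
  bilinC (fun X Y => half * eta (lie_bracket X Y)) (anchor u) (anchor v).
Proof.
rewrite cpairing_of_real !pairing_eta.
by apply: cplx_eq; rewrite /= one_formD ?one_formN mulrDr ?mulrN.
Qed.

Lemma anchor_eta (f : C^cplx) w : anchor (f *: etaC + w) = anchor w.
Proof.
by apply: cplx_eq; rewrite /= !scaler0 ?subr0 ?addr0 add0r.
Qed.

Section Closedness.
Hypothesis closedL : courant_closed (gac_L J).

(** The conjugates of [u], [v], [w] lie in the closed isotropic [gac_L J]. *)
Lemma cdorfman_E01_isotropic u v w : E01 J u -> E01 J v -> E01 J w ->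
  <<u ∘ v, w>> = 0.
Proof.
move=> /E01_conj Eu /E01_conj Ev /E01_conj Ew.
rewrite -[LHS]conjCK -cpairing_conj.
rewrite /cdorfman -(bilinC_conj (dorfman_biadditive M)).
rewrite gac_L_isotropic ?conjC0 //; last exact: line_plus_sub.
by apply: (closed_cdorfman gac_L_isotropic) => //; exact: line_plus_sub.
Qed.

Lemma gac_Lstar_closedE : courant_closed (gac_Lstar J) <->
  (forall u v, E01 J u -> E01 J v -> <<u ∘ v, etaC>> = 0).
Proof.
have iL := gac_Lstar_isotropic.
have etaB : gac_Lstar J etaC.
  exists 1, 0; rewrite scale1r addr0; split=> //; exact: E01_submodule.1.
have etaE u : gac_Lstar J u -> <<u, etaC>> = 0.
  by move=> Lu; apply: iL.
split=> [cL u v Eu Ev|d0].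
  by apply/etaE/(closed_cdorfman iL cL); exact: line_plus_sub.
(* Adding a multiple of [eta] to [u] or [v] does not change the anchors. *)
have Teta u v : gac_Lstar J u -> gac_Lstar J v -> <<u ∘ v, etaC>> = 0.
  move=> [f [u' [Eu ->]]] [g [v' [Ev ->]]].
  by rewrite cdorfman_eta !anchor_eta -cdorfman_eta d0.
(* On an isotropic submodule [<<u ∘ v, w>>] is cyclically invariant. *)
have cyc u v w : gac_Lstar J u -> gac_Lstar J v -> gac_Lstar J w ->
    <<u ∘ v, w>> = <<v ∘ w, u>>.
  move=> Lu Lv Lw; rewrite -[u ∘ v]opprK -(isotropic_cdorfmanC iL) //.
  rewrite cpairingNl; apply/eqP; rewrite eqr_oppLR -addr_eq0 (cpairingC _ u); apply/eqP.
  by rewrite -[LHS]addrC addrC -cpairing_invariant iL // rho0.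
(* Hence the component along [eta] of any argument of [<<u ∘ v, w>>] can be
   dropped, which leaves three sections of [E01 J]. *)
have red u v f w : gac_Lstar J u -> gac_Lstar J v ->
    <<u ∘ v, f *: etaC + w>> = <<u ∘ v, w>>.
  by move=> Lu Lv; rewrite cpairingDr cpairingZr Teta // mulr0 add0r.
move=> u v Lu Lv; rewrite (isotropic_ccourant iL) //.
apply: (transverse_orthogonal iL gac_L_isotropic
  (complementaryC gac_complementary)) => w Lw.
have [[f [u' [Eu ue]]] [g [v' [Ev ve]]] [h [w' [Ew we]]]] := And3 Lu Lv Lw.
have [Lu' Lv' Lw'] : [/\ gac_Lstar J u', gac_Lstar J v' & gac_Lstar J w'].
  by split; exact: line_plus_sub.
rewrite we red // cyc // ue red // cyc // ve red //.
exact: cdorfman_E01_isotropic.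
Qed.
End Closedness.
End ContactBundles.

Theorem theorem2p7 (R : realType) (n : nat) (n_odd : odd n)
    (M : smooth_manifold R n) (J : gac_pair M) (J_contact : generalized_contact J) :
  lie_bialgebroid (gac_L J) (gac_Lstar J) <-> d_eta_type11 J.
Proof.
have cL : courant_closed (gac_L J) := J_contact.
have bialg := transverse_lie_bialgebroid (gac_L_submodule J) (gac_Lstar_submodule J)
  (@gac_L_isotropic _ _ _ J) (@gac_Lstar_isotropic _ _ _ J)
  (@gac_complementary _ _ _ J).
apply: (iff_trans bialg); apply: iff_trans (iff_sym (d_eta_type11E J)).
apply: iff_trans (gac_Lstar_closedE cL).
by split=> [[]|].
Qed.
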